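(* There is an FO$[<,E]$ sentence $\varphi$ that has no equivalent HyperLTL sentence: for every HyperLTL sentence $\varphi'$ there are two sets $T_0$ and $T_1$ of traces such that (1) $\mathcal{M}(T_0)\not\models\varphi$ and $\mathcal{M}(T_1)\models\varphi$, but (2) $\varphi'$ cannot distinguish $T_0$ and $T_1$, i.e., either both $T_0\models\varphi'$ and $T_1\models\varphi'$, or both $T_0\not\models\varphi'$ and $T_1\not\models\varphi'$.
   Context: Fix a finite set $AP$ of atomic propositions. A trace over $AP$ is a map $t:\mathbb{N}\to 2^{AP}$. HyperLTL formulas are given by the grammar $\varphi ::= \exists \pi.\ \varphi \mid \forall \pi.\ \varphi \mid \psi$ and $\psi ::= a_\pi \mid \neg\psi \mid \psi\vee\psi \mid \mathbf{X}\psi \mid \psi\,\mathbf{U}\,\psi$, where $a\in AP$ and $\pi$ ranges over a countable set of trace variables. For a set $T$ of traces and a trace assignment $\Pi$ (a partial map from trace variables to traces), with $\Pi[j]$ mapping each $\pi$ in the domain of $\Pi$ to the suffix $\Pi(\pi)(j)\Pi(\pi)(j+1)\cdots$: $(T,\Pi)\models a_\pi$ iff $a\in\Pi(\pi)(0)$; negation and disjunction as usual; $(T,\Pi)\models\mathbf{X}\psi$ iff $(T,\Pi[1])\models\psi$; $(T,\Pi)\models\psi_1\mathbf{U}\psi_2$ iff there is $j\ge0$ with $(T,\Pi[j])\models\psi_2$ and $(T,\Pi[j'])\models\psi_1$ for all $0\le j'<j$; $(T,\Pi)\models\exists\pi.\varphi$ iff some $t\in T$ has $(T,\Pi[\pi\mapsto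 t])\models\varphi$; $(T,\Pi)\models\forall\pi.\varphi$ iff all $t\in T$ do. A sentence has no free trace variables; $T\models\varphi$ means $(T,\Pi_\emptyset)\models\varphi$ for the empty assignment. For a set $T$ of traces, $\mathcal{M}(T)$ is the relational structure with domain $T\times\mathbb{N}$, the relation $<$ interpreted as $\{((t,n),(t,n')) : t\in T,\ n<n'\}$, the binary equal-level relation $E$ interpreted as $\{((t,n),(t',n)) : t,t'\in T,\ n\in\mathbb{N}\}$, and for each $a\in AP$ a unary relation $P_a$ interpreted as $\{(t,n) : a\in t(n)\}$. FO$[<,E]$ is first-order logic with equality over the signature $\{<,E\}\cup\{P_a : a\in AP\}$. *)

(* Defs.v *)
From mathcomp Require Import all_boot.
From mathcomp Require Import boolp classical_sets.

Set Implicit Arguments.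
Unset Strict Implicit.
Unset Printing Implicit Defensive.

(* Variables of both logics are natural numbers.  Assignments are partial:
   sentences are evaluated under the empty assignment, which exists even when
   the universe is empty (the set of traces may be empty). *)
Definition assignment (D : Type) : Type := nat -> option D.

Definition empty_assignment {D : Type} : assignment D := fun=> None.

Definition update {D : Type} (v : assignment D) (x : nat) (d : D) :
    assignment D :=
  fun y => if y == x then Some d else v y.

Definition trace (AP : finType) : Type := nat -> {set AP}.

Definition trace_suffix (AP : finType) (j : nat) (t : trace AP) : trace AP :=
  fun n => t (j + n).

Definition shift (AP : finType) (j : nat) (Pi : assignment (trace AP)) :
    assignment (trace AP) :=
  fun x => omap (trace_suffix j) (Pi x).

Inductive ltl (AP : finType) : Type :=
  | LAtom of AP & nat
  | LNot of ltl AP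
  | LOr of ltl AP & ltl AP
  | LNext of ltl AP
  | LUntil of ltl AP & ltl AP.

Inductive hyperltl (AP : finType) : Type :=
  | HExists of nat & hyperltl AP
  | HForall of nat & hyperltl AP
  | HBody of ltl AP.

(* An atom whose trace variable is unassigned is false; this never occurs in
   the evaluation of a sentence. *)
Fixpoint ltl_sat (AP : finType) (Pi : assignment (trace AP)) (psi : ltl AP) :
    Prop :=
  match psi with
  | LAtom a x => exists2 t, Pi x = Some t & a \in t 0
  | LNot psi1 => ~ ltl_sat Pi psi1
  | LOr psi1 psi2 => ltl_sat Pi psi1 \/ ltl_sat Pi psi2
  | LNext psi1 => ltl_sat (shift 1 Pi) psi1
  | LUntil psi1 psi2 =>
      exists2 j, ltl_sat (shift j Pi) psi2
               & forall j', j' < j -> ltl_sat (shift j' Pi) psi1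
  end.

Fixpoint hyperltl_sat (AP : finType) (T : set (trace AP))
    (Pi : assignment (trace AP)) (phi : hyperltl AP) : Prop :=
  match phi with
  | HExists x phi1 => exists2 t, T t & hyperltl_sat T (update Pi x t) phi1
  | HForall x phi1 => forall t, T t -> hyperltl_sat T (update Pi x t) phi1
  | HBody psi => ltl_sat Pi psi
  end.

Fixpoint ltl_vars (AP : finType) (psi : ltl AP) : seq nat :=
  match psi with
  | LAtom _ x => [:: x]
  | LNot psi1 | LNext psi1 => ltl_vars psi1
  | LOr psi1 psi2 | LUntil psi1 psi2 => ltl_vars psi1 ++ ltl_vars psi2
  end.

Fixpoint hyperltl_free (AP : finType) (phi : hyperltl AP) : seq nat :=
  match phi with
  | HExists x phi1 | HForall x phi1 => [seq y <- hyperltl_free phi1 | y != x]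
  | HBody psi => ltl_vars psi
  end.

Definition hyperltl_sentence (AP : finType) (phi : hyperltl AP) : Prop :=
  hyperltl_free phi = [::].

Definition hyperltl_models (AP : finType) (T : set (trace AP))
    (phi : hyperltl AP) : Prop :=
  hyperltl_sat T empty_assignment phi.

Inductive fo (AP : finType) : Type :=
  | FEq of nat & nat
  | FLt of nat & nat
  | FLevel of nat & nat
  | FPred of AP & nat
  | FNot of fo AP
  | FOr of fo AP & fo AP
  | FAnd of fo AP & fo AP
  | FExists of nat & fo AP
  | FForall of nat & fo AP.

Record structure (AP : finType) : Type := Structure {
  dom : Type;
  lt_rel : dom -> dom -> Prop;
  level_rel : dom -> dom -> Prop;
  pred_rel : AP -> dom -> Prop
}.

Definition atom1 {D : Type} (v : assignment D) (P : D -> Prop) (x : nat) :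
    Prop :=
  exists2 d, v x = Some d & P d.

Definition atom2 {D : Type} (v : assignment D) (R : D -> D -> Prop)
    (x y : nat) : Prop :=
  exists d e, [/\ v x = Some d, v y = Some e & R d e].

Fixpoint fo_sat (AP : finType) (S : structure AP) (v : assignment (dom S))
    (phi : fo AP) : Prop :=
  match phi with
  | FEq x y => atom2 v eq x y
  | FLt x y => atom2 v (@lt_rel AP S) x y
  | FLevel x y => atom2 v (@level_rel AP S) x y
  | FPred a x => atom1 v (@pred_rel AP S a) x
  | FNot phi1 => ~ fo_sat v phi1
  | FOr phi1 phi2 => fo_sat v phi1 \/ fo_sat v phi2
  | FAnd phi1 phi2 => fo_sat v phi1 /\ fo_sat v phi2
  | FExists x phi1 => exists d : dom S, fo_sat (update v x d) phi1
  | FForall x phi1 => forall d : dom S, fo_sat (update v x d) phi1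
  end.

Fixpoint fo_free (AP : finType) (phi : fo AP) : seq nat :=
  match phi with
  | FEq x y | FLt x y | FLevel x y => [:: x; y]
  | FPred _ x => [:: x]
  | FNot phi1 => fo_free phi1
  | FOr phi1 phi2 | FAnd phi1 phi2 => fo_free phi1 ++ fo_free phi2
  | FExists x phi1 | FForall x phi1 => [seq y <- fo_free phi1 | y != x]
  end.

Definition fo_sentence (AP : finType) (phi : fo AP) : Prop :=
  fo_free phi = [::].

Definition fo_models (AP : finType) (S : structure AP) (phi : fo AP) : Prop :=
  @fo_sat AP S empty_assignment phi.

(* Membership in [set_type T] is boolean, so equality of elements of the
   domain is equality of the underlying pairs of a trace and a position. *)
Definition trace_structure (AP : finType) (T : set (trace AP)) :
    structure AP :=
  @Structure AP (set_type T * nat)%type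
    (fun p q => p.1 = q.1 /\ p.2 < q.2)
    (fun p q => p.2 = q.2)
    (fun a p => a \in val p.1 p.2).

(* Main.v *)
Require Import Defs.
From mathcomp Require Import all_boot.
From mathcomp Require Import boolp classical_sets.

(** The sentence says that some level carries no [p].  Fix a HyperLTL sentence
    with [k] quantifiers, let [N = k + 1], and view [N] traces as one infinite
    word over letters in ['I_N], the letter [i] meaning that exactly trace [i]
    has [p] at that level.  For every LTL formula there are a finite word [u]
    and an infinite word [R] such that inserting any finite word between [u]
    and [R] does not change its truth value, whatever precedes [u]; both can be
    chosen uniformly for the finitely many ways of instantiating the
    quantifiers.  Then [u R] gives [T_0], where every level carries a [p], and
    [u _ R], with an empty level inserted, gives [T_1].  An instance of the
    matrix uses at most [k] of the traces, so it cannot tell the empty level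
    from the letter of an unused trace, whose insertion goes unnoticed. *)

Set Implicit Arguments.
Unset Strict Implicit.
Unset Printing Implicit Defensive.

(** * Conditions on a finite word and an infinite tail *)

Section Words.
Variable C : Type.
Implicit Types (c : C) (W R : nat -> C) (a s u x y z : seq C).

Definition wcons c W : nat -> C := fun n => if n is m.+1 then W m else c.

Definition wcat s W : nat -> C := foldr wcons W s.

Lemma wcat_cat s1 s2 W : wcat (s1 ++ s2) W = wcat s1 (wcat s2 W).
Proof. exact: foldr_cat. Qed.

Lemma wcat_size s W n : wcat s W (size s + n) = W n.
Proof. by elim: s => //= c s IHs; rewrite addSn. Qed.

(** Closure under enlargement lets conditions be met one after another: a later one only lengthens
    the pair found for the earlier ones. *)
Definition attainable (G : seq C -> (nat -> C) -> Prop) : Prop :=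
  (forall u R x y z, G u R -> G (y ++ u ++ z) (wcat x R)) /\
  forall R, exists x u, G u (wcat x R).

Lemma attainable_and G1 G2 : attainable G1 -> attainable G2 ->
  attainable (fun u R => G1 u R /\ G2 u R).
Proof.
move=> [mono1 ex1] [mono2 ex2]; split=> [u R x y z []|R].
  by split; [apply: mono1 | apply: mono2].
have [x1 [u1 G1u]] := ex1 R.
have [x2 [u2 G2u]] := ex2 (wcat x1 R).
exists (x2 ++ x1), (u1 ++ u2); rewrite wcat_cat; split.
  exact: (mono1 _ _ x2 [::] u2).
by have := mono2 _ _ [::] u1 [::] G2u; rewrite cats0.
Qed.

Lemma attainable_forall (I : finType) (G : I -> seq C -> (nat -> C) -> Prop) :
  (forall i, attainable (G i)) -> attainable (fun u R => forall i, G i u R).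
Proof.
move=> attG; have: attainable (fun u R => forall i, i \in enum I -> G i u R).
  elim: (enum I) => [|i r IHr]; first by split=> // R; exists [::], [::].
  have [mono ex] := attainable_and (attG i) IHr.
  split=> [u R x y z Gu j jr|R].
    by apply: (attG j).1; apply: Gu.
  have [x [u [Gi Gr]]] := ex R; exists x, u => j.
  by rewrite inE => /orP[/eqP-> //|]; apply: Gr.
move=> [_ ex]; split=> [u R x y z Gu i|R].
  by apply: (attG i).1; apply: Gu.
have [x [u Gu]] := ex R; exists x, u => i.
by apply: Gu; rewrite mem_enum.
Qed.

End Words.

(** * Insertion into words and the truth of LTL formulas *)

Section Labelled.
Variables (AP : finType) (C I : Type) (l : C -> I -> {set AP}).
Implicit Types (W R : nat -> C) (f : assignment I) (psi : ltl AP).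

Definition word_trace W (i : I) : trace AP := fun n => l (W n) i.

Definition word_assignment f W : assignment (trace AP) :=
  fun x => omap (word_trace W) (f x).

Definition word_traces W : set (trace AP) := range (word_trace W).

Lemma shift_word j f W :
  shift j (word_assignment f W) = word_assignment f (fun n => W (j + n)).
Proof. by apply: funext => x; rewrite /shift /word_assignment; case: (f x). Qed.

Lemma shift1_wcons f c W :
  shift 1 (word_assignment f (wcons c W)) = word_assignment f W.
Proof. by rewrite shift_word. Qed.

Lemma update_word f W x i :
  update (word_assignment f W) x (word_trace W i) =
  word_assignment (update f x i) W.
Proof.
by apply: funext => y; rewrite /update /word_assignment; case: eqP.
Qed.

Definition word_sat f W psi : Prop := ltl_sat (word_assignment f W) psi.

Lemma word_sat_untilE f W psi1 psi2 :
  word_sat f W (LUntil psi1 psi2) <->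
  word_sat f W psi2 \/
  word_sat f W psi1 /\ word_sat f (fun n => W n.+1) (LUntil psi1 psi2).
Proof.
rewrite /word_sat /=; split=> [[[|j]]|].
- by rewrite shift_word => sat2 _; left.
- rewrite shift_word => sat2 sat1; right; split.
    by have := sat1 0 isT; rewrite shift_word.
  exists j; first by rewrite shift_word.
  by move=> i ij; have := sat1 i.+1 ij; rewrite !shift_word.
- case=> [sat2|[sat1 [j sat2 sat1']]]; first by exists 0; rewrite ?shift_word.
  exists j.+1; first by move: sat2; rewrite !shift_word.
  case=> [|i] ij; first by rewrite shift_word.
  by have := sat1' i ij; rewrite !shift_word.
Qed.

Definition insensitive f psi (u : seq C) R : Prop :=
  forall a s, word_sat f (wcat (a ++ u ++ s) R) psi <->
              word_sat f (wcat (a ++ u) R) psi.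

(** After the prefix [a ++ y], inserting [z ++ s ++ x] or [z ++ x] between [u] and [R] changes
    nothing, so the two results agree. *)
Lemma insensitive_mono f psi u R x y z :
  insensitive f psi u R -> insensitive f psi (y ++ u ++ z) (wcat x R).
Proof.
move=> ins a s; rewrite -!wcat_cat.
have := ins (a ++ y) (z ++ s ++ x); have := ins (a ++ y) (z ++ x).
by rewrite -!catA => <- <-.
Qed.

Lemma attainable_insensitive (c0 : C) f psi : attainable (insensitive f psi).
Proof.
split; first by move=> *; apply: insensitive_mono.
elim: psi => [p x|psi IH|psi1 IH1 psi2 IH2|psi IH|psi1 IH1 psi2 IH2] R.
(* A nonempty [u] keeps the first letter, which alone decides an atom, ahead of the insertion. *)
- exists [::], [:: c0] => a s; rewrite /word_sat /= /word_assignment.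
  by case: (f x) a => [i|] [|c a] /=; split=> -[t] // [<-] ?;
     eexists; try reflexivity.
- have [x [u ins]] := IH R; exists x, u => a s.
  by have := ins a s; rewrite /word_sat /= => ->.
- have [x [u [ins1 ins2]]] : exists x u,
      insensitive f psi1 u (wcat x R) /\ insensitive f psi2 u (wcat x R).
    by apply: (attainable_and _ _).2; split=> // *; apply: insensitive_mono.
  exists x, u => a s; have := ins1 a s; have := ins2 a s.
  by rewrite /word_sat /= => -> ->.
(* The extra letter absorbs the shift when [a] is empty; otherwise it joins the prefix. *)
- have [x [u ins]] := IH R; exists x, (c0 :: u) => a s.
  rewrite /word_sat /=; case: a => [|c a] /=; rewrite !shift1_wcons.
    exact: (ins [::] s).
  by have := ins (a ++ [:: c0]) s; rewrite -!catA.
have [x [u [ins1 ins2]]] : exists x u,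
    insensitive f psi1 u (wcat x R) /\ insensitive f psi2 u (wcat x R).
  by apply: (attainable_and _ _).2; split=> // *; apply: insensitive_mono.
set Q := wcat x R in ins1 ins2.
(* Either some word [z] settles the until at its first position, whatever is
   inserted after [u], or no position before [u Q] ever settles it. *)
have [[z settled]|unsettled] := pselect (exists z,
    word_sat f (wcat (z ++ u) Q) psi2 \/ ~ word_sat f (wcat (z ++ u) Q) psi1).
- exists x, (z ++ u) => a s; rewrite -/Q.
  elim: a => [|c a IHa].
    have := word_sat_untilE f (wcat ((z ++ u) ++ s) Q) psi1 psi2.
    have := word_sat_untilE f (wcat (z ++ u) Q) psi1 psi2.
    by have := ins1 z s; have := ins2 z s; rewrite catA; tauto.
  have := word_sat_untilE f (wcat ((c :: a) ++ (z ++ u) ++ s) Q) psi1 psi2.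
  have := word_sat_untilE f (wcat ((c :: a) ++ z ++ u) Q) psi1 psi2.
  have := ins1 (c :: a ++ z) s; have := ins2 (c :: a ++ z) s.
  by move: IHa; rewrite /= -!catA /=; tauto.
(* A second copy of [u] heads the tail, so every position before it, inserted or not, is followed by
   [u Q]. There [psi1] holds and [psi2] fails, so the until takes its value on [u Q]. *)
- exists (u ++ x), u => a s; rewrite !wcat_cat -/Q.
  have untilE z : word_sat f (wcat z (wcat u Q)) (LUntil psi1 psi2) <->
                  word_sat f (wcat u Q) (LUntil psi1 psi2).
    elim: z => [//|c z IHz].
    have := word_sat_untilE f (wcat (c :: z) (wcat u Q)) psi1 psi2.
    rewrite -wcat_cat.
    have : ~ word_sat f (wcat ((c :: z) ++ u) Q) psi2.
      by move=> sat2; apply: unsettled; exists (c :: z); left.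
    have : word_sat f (wcat ((c :: z) ++ u) Q) psi1.
      by apply: contrapT => sat1; apply: unsettled; exists (c :: z); right.
    by move: IHz; rewrite -!wcat_cat /=; tauto.
  have := untilE (a ++ u ++ s); have := untilE (a ++ u).
  by rewrite -!wcat_cat -!catA; tauto.
Qed.

End Labelled.

(** * Quantifiers and the two sets of traces *)

Fixpoint quantifiers (AP : finType) (phi : hyperltl AP) : nat :=
  match phi with
  | HExists _ phi1 | HForall _ phi1 => (quantifiers phi1).+1
  | HBody _ => 0
  end.

Section Traces.
Variables (AP : finType) (p : AP) (N : nat).
Implicit Types (f : assignment 'I_N) (W R : nat -> 'I_N) (phi : hyperltl AP).

Definition letter (c i : 'I_N) : {set AP} :=
  if c == i then finset.set1 p else finset.set0.

(* [None] is the letter of an empty level. *)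
Definition oletter (c : option 'I_N) (i : 'I_N) : {set AP} :=
  if c == Some i then finset.set1 p else finset.set0.

Lemma word_assignment_oletter f W :
  word_assignment oletter f (Some \o W) = word_assignment letter f W.
Proof. by []. Qed.

Lemma word_assignment_None f u R i : (forall x, f x <> Some i) ->
  word_assignment oletter f (wcat (rcons (map Some u) None) (Some \o R)) =
  word_assignment letter f (wcat (rcons u i) R).
Proof.
move=> fi; apply: funext => x; rewrite /word_assignment.
case fx: (f x) => [j|] //=; congr Some; apply: funext => n.
have ij : i != j by apply/eqP => ij; apply: (fi x); rewrite fx ij.
rewrite /word_trace /oletter /letter.
elim: u n => [|c u IHu] [|n] //=; first by rewrite (negPf ij).
Qed.

Fixpoint hyper_insensitive phi f (u : seq 'I_N) R : Prop :=
  match phi with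
  | HExists x phi1 | HForall x phi1 =>
      forall i, hyper_insensitive phi1 (update f x i) u R
  | HBody psi => insensitive letter f psi u R
  end.

Lemma attainable_hyper (c0 : 'I_N) phi f :
  attainable (hyper_insensitive phi f).
Proof.
elim: phi f => [x phi IH|x phi IH|psi] f /=.
- by apply: attainable_forall => i; apply: IH.
- by apply: attainable_forall => i; apply: IH.
- exact: attainable_insensitive.
Qed.

(** Traces of the two sets are matched by index, and [s] records the indices in use. Each quantifier
    moves one unit from [quantifiers phi] to [size s], so an index outside [s] is left at the
    matrix. *)
Lemma hyper_sat_insert phi f u R (s : seq 'I_N) :
    hyper_insensitive phi f u R ->
    size s + quantifiers phi < N -> (forall x i, f x = Some i -> i \in s) ->
  let W0 := Some \o wcat u R in
  let W1 := wcat (rcons (map Some u) None) (Some \o R) in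
  hyperltl_sat (word_traces oletter W0) (word_assignment oletter f W0) phi <->
  hyperltl_sat (word_traces oletter W1) (word_assignment oletter f W1) phi.
Proof.
move=> + + + W0 W1.
elim: phi f s => [x phi IH|x phi IH|psi] f s /= ins sz fs; last first.
  rewrite /W0 /W1 word_assignment_oletter.
  have [i si] : exists i, i \notin s.
    apply/existsP; rewrite -negb_forall; apply: contraTN sz => /forallP full.
    rewrite addn0 -leqNgt; apply: leq_trans (card_size s).
    by rewrite -{1}(card_ord N); apply: subset_leq_card; apply/fintype.subsetP.
  rewrite (@word_assignment_None f u R i) => [|x /fs]; last first.
    by rewrite (negPf si).
  by apply: iff_sym; have := ins [::] [:: i]; rewrite cats1.
all: have {}IH i : hyperltl_sat (word_traces oletter W0)
           (word_assignment oletter (update f x i) W0) phi <->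
         hyperltl_sat (word_traces oletter W1)
           (word_assignment oletter (update f x i) W1) phi.
1,3: by apply: (IH _ (i :: s)) => [//||y j]; rewrite /= ?addSnnS // inE /update;
     case: (y == x) => [[->]|/fs->]; rewrite ?eqxx ?orbT.
- split=> sat _ [i _ <-]; rewrite update_word.
    by apply/IH; rewrite -update_word; apply: sat; exists i.
  by apply/IH; rewrite -update_word; apply: sat; exists i.
- split=> -[_ [i _ <-]]; rewrite update_word => sat.
    by exists (word_trace oletter W1 i); [exists i | rewrite update_word -IH].
  by exists (word_trace oletter W0 i); [exists i | rewrite update_word IH].
Qed.

Definition silent_level : fo AP :=
  FExists 0 (FForall 1 (FOr (FNot (FLevel AP 0 1)) (FNot (FPred p 1)))).

Lemma silent_levelP (c0 : 'I_N) (W : nat -> option 'I_N) :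
  fo_models (trace_structure (word_traces oletter W)) silent_level <->
  exists n, W n = None.
Proof.
have inT i : word_trace oletter W i \in word_traces oletter W.
  by rewrite inE; exists i.
pose pt i : set_type (word_traces oletter W) := SigSub (inT i).
split=> [[[t n] silent]|[n Wn]].
- exists n; case Wn: (W n) => [i|] //.
  have [[]|[]] := silent (pt i, n).
    by exists (t, n), (pt i, n).
  exists (pt i, n) => //=.
  by rewrite /word_trace /oletter Wn eqxx inE.
(* The index [c0] guarantees a trace, hence a point on level [n]. *)
exists (pt c0, n) => -[t m] /=.
have [nm|nm] := eqVneq n m; last first.
  left=> -[d [e [[<-] [<-] /= nm']]].
  by rewrite nm' eqxx in nm.
right=> -[d [<-] /=]; case: t => t /= /[dup] /set_mem [i _ <-] _.
by rewrite /word_trace /oletter -nm Wn inE.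
Qed.

End Traces.

Theorem theorem7 (AP : finType) :
  exists phi : fo AP,
    fo_sentence phi /\
    forall phi' : hyperltl AP, hyperltl_sentence phi' ->
      exists T0 T1 : set (trace AP),
        (~ fo_models (trace_structure T0) phi /\
         fo_models (trace_structure T1) phi) /\
        ((hyperltl_models T0 phi' /\ hyperltl_models T1 phi') \/
         (~ hyperltl_models T0 phi' /\ ~ hyperltl_models T1 phi')).
Proof.
case: (pickP AP) => [p _|AP0]; last first.
  (* Without atomic propositions the grammar generates no formula at all. *)
  exists (FExists 0 (FEq AP 0 0)); split=> // phi' _.
  by exfalso; elim: phi' => // psi; elim: psi => // p; have := AP0 p.
exists (silent_level p); split=> // phi' _.
pose N := (quantifiers phi').+1; pose c0 : 'I_N := ord0.
have [_ ex] := @attainable_hyper _ p N c0 phi' empty_assignment.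
(* The constant word is an arbitrary starting tail. *)
have {ex} [x [u]] := ex (fun=> c0); move: (wcat x _) => R ins.
pose T0 := word_traces (oletter p (N := N)) (Some \o wcat u R).
pose T1 := word_traces (oletter p (N := N))
  (wcat (rcons (map Some u) None) (Some \o R)).
exists T0, T1; split.
  split; rewrite (silent_levelP p c0); first by case.
  exists (size u); rewrite -cats1 wcat_cat.
  by rewrite -(size_map Some) -[size _]addn0 wcat_size.
have sat_iff : hyperltl_models T0 phi' <-> hyperltl_models T1 phi'.
  exact: (@hyper_sat_insert _ p N phi' empty_assignment u R [::]).
by case: (pselect (hyperltl_models T0 phi')); tauto.
Qed.
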